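(* Let $X$ be a simplicial set, $G$ a simplicial group, $\tau\colon X_{>0}\to G$ a twisting function and $F$ a left $G$-space. Szczarba's twisting cochain $t$ and the twisted shuffle map $\psi$ descend to the normalized chain complexes: the formulas defining them on (non-normalized) chains send degenerate chains to degenerate chains, so that $t\colon C(X)\to C(G)$ and $\psi\colon C(X)\otimes_tC(F)\to C(X\times_\tau F)$ are well-defined on normalized chains.
   Context: **Conventions.** $\Bbbk$ is a commutative ring with unit. Normalized chains are the quotient of the non-normalized chains (free $\Bbbk$-module on $X_n$ in degree $n$) by the submodule spanned by degenerate simplices. For the tensor product, the submodule of degenerate elements is spanned by the $x\otimes y$ with $x$ or $y$ degenerate. **Twisting function.** $\tau$ maps $X_n$ to $G_{n-1}$ and satisfies, for $x\in X_n$, $n>0$ (whenever defined): $\partial_0\tau(x)=\tau(\partial_0x)^{-1}\tau(\partial_1x)$; $\partial_k\tau(x)=\tau(\partial_{k+1}x)$ for $0<k<n$; $s_k\tau(x)=\tau(s_{k+1}x)$ for $0\le k<n$; and $\tau(s_0x)=1\in G_n$ for $x\in X_n$, $n\ge0$. Write $\sigma(x)=\tau(x)^{-1}$. $X\times_\tau F$ is $X\times F$ except that $\partial_0(x,y)=(\partial_0x,\tau(x)\,\partial_0y)$. **Definitions of $t$ and $\psi$.** $S_n=\{\mathbf i=(i_1,\dots,i_n)\in\mathbb N^n: 0\le i_s\le n-s\}$, $|\mathbf i|=i_1+\dots+i_n$ ($S_0=\{\emptyset\}$). For a simplicial operator $D$ let $D'$ be its derived operator, obtained by increasing the indices of all face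 and degeneracy maps in $D$ by one. For $0\le k\le n$, $\mathbf i\in S_n$, $m\ge n-k$, the operators $D_{\mathbf i,k}$ (from dimension $m$ to dimension $m+k$) are defined recursively by $D_{\emptyset,0}=\mathrm{id}$ and, for $n\ge1$ and $\mathbf i'=(i_2,\dots,i_n)$: $D_{\mathbf i,k}=D'_{\mathbf i',k}\,s_0\,\partial_{i_1-k}$ if $k<i_1$; $D_{\mathbf i,k}=D'_{\mathbf i',k}$ if $k=i_1$; $D_{\mathbf i,k}=D'_{\mathbf i',k-1}\,s_0$ if $k>i_1$. For $n\ge1$, $\mathbf i\in S_{n-1}$, $x\in X_n$: $\mathrm{Sz}_{\mathbf i}x=D_{\mathbf i,0}\sigma(x)\cdot D_{\mathbf i,1}\sigma(\partial_0x)\cdots D_{\mathbf i,n-1}\sigma((\partial_0)^{n-1}x)\in G_{n-1}$. Then $t(x)=0$ if $n=0$; $t(x)=\sigma(x)-1$ if $n=1$; $t(x)=\sum_{\mathbf i\in S_{n-1}}(-1)^{|\mathbf i|}\mathrm{Sz}_{\mathbf i}x$ if $n\ge2$. For $n\ge0$, $\mathbf i\in S_n$, $x\in X_n$: $\widehat{\mathrm{Sz}}_{\mathbf i}x=\bigl(D_{\mathbf i,0}x,\ D_{\mathbf i,1}\sigma(x)\cdot D_{\mathbf i,2}\sigma(\partial_0x)\cdots D_{\mathbf i,n}\sigma((\partial_0)^{n-1}x)\bigr)\in(X\times_\tau G)_n$ (for $n=0$: $(x,1)$). With $\mu_F\colon G\times F\to F$ the action and $\nabla$ the Eilenberg–Zilber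 shuffle map, $\psi(x\otimes y)=\sum_{\mathbf i\in S_n}(-1)^{|\mathbf i|}(\mathrm{id}_X,\mu_F)_*\nabla(\widehat{\mathrm{Sz}}_{\mathbf i}x\otimes y)$. *)

(* Defs.v *)
From HB Require Import structures.
From mathcomp Require Import all_boot all_order all_algebra.
From mathcomp Require Import generic_quotient finmap boolp monalg zify.

Set Implicit Arguments.
Unset Strict Implicit.
Unset Printing Implicit Defensive.

Import GRing.Theory.
Local Open Scope ring_scope.
Local Open Scope quotient_scope.

(* Face and degeneracy maps are indexed by nat and every law is restricted to
   meaningful indices: [d n i : X n.+1 -> X n] is a face map for i <= n.+1, and
   [s n i : X n -> X n.+1] a degeneracy map for i <= n.  The values at other
   indices are unconstrained and play no role (see [Dop_valid] below). *)
Record simplicial_laws (X : nat -> Type)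
    (d : forall n, nat -> X n.+1 -> X n) (s : forall n, nat -> X n -> X n.+1)
    : Prop := SimplicialLaws {
  law_dd : forall n i j (x : X n.+2), (i < j <= n.+2)%N ->
    d n i (d n.+1 j x) = d n j.-1 (d n.+1 i x);
  law_ds_lt : forall n i j (x : X n.+1), (i < j <= n.+1)%N ->
    d n.+1 i (s n.+1 j x) = s n j.-1 (d n i x);
  law_ds_id : forall n j (x : X n), (j <= n)%N -> d n j (s n j x) = x;
  law_ds_idS : forall n j (x : X n), (j <= n)%N -> d n j.+1 (s n j x) = x;
  law_ds_gt : forall n i j (x : X n.+1), (j.+1 < i <= n.+2)%N ->
    d n.+1 i (s n.+1 j x) = s n j (d n i.-1 x);
  law_ss : forall n i j (x : X n), (i <= j <= n)%N ->
    s n.+1 i (s n j x) = s n.+1 j.+1 (s n i x)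
}.

Record sset := SSet {
  sobj :> nat -> choiceType;
  face : forall n, nat -> sobj n.+1 -> sobj n;
  deg : forall n, nat -> sobj n -> sobj n.+1;
  sset_laws : simplicial_laws face deg
}.
Arguments face X {n} i x : rename.
Arguments deg X {n} i x : rename.

Record sgroup := SGroup {
  gobj :> nat -> groupType;
  gface : forall n, nat -> gobj n.+1 -> gobj n;
  gdeg : forall n, nat -> gobj n -> gobj n.+1;
  sgroup_laws : simplicial_laws gface gdeg;
  gfaceM : forall n i, (i <= n.+1)%N -> {morph @gface n i : a b / (a * b)%g};
  gdegM : forall n i, (i <= n)%N -> {morph @gdeg n i : a b / (a * b)%g}
}.
Arguments gface G {n} i x : rename.
Arguments gdeg G {n} i x : rename.

Coercion sset_of_sgroup (G : sgroup) : sset :=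
  @SSet (fun n => G n : choiceType) (@gface G) (@gdeg G) (sgroup_laws G).

Record gspace (G : sgroup) := GSpace {
  gsp :> sset;
  act : forall n, gobj G n -> gsp n -> gsp n;
  act1 : forall n (y : gsp n), act 1%g y = y;
  actM : forall n (a b : gobj G n) (y : gsp n),
    act (a * b)%g y = act a (act b y);
  act_face : forall n i (a : gobj G n.+1) (y : gsp n.+1), (i <= n.+1)%N ->
    face gsp i (act a y) = act (gface G i a) (face gsp i y);
  act_deg : forall n i (a : gobj G n) (y : gsp n), (i <= n)%N ->
    deg gsp i (act a y) = act (gdeg G i a) (deg gsp i y)
}.
Arguments act {G} F {n} a y : rename.

Definition gspace_self (G : sgroup) : gspace G.
Proof.
exists (sset_of_sgroup G) (fun n (a b : gobj G n) => (a * b)%g).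
- by move=> n y; rewrite mul1g.
- by move=> n a b y; rewrite mulgA.
- by move=> n i a y le_in; apply: gfaceM.
- by move=> n i a y le_in; apply: gdegM.
Defined.

Record twisting (X : sset) (G : sgroup) := Twisting {
  tau :> forall n, X n.+1 -> gobj G n;
  tau_face0 : forall n (x : X n.+2), gface G 0 (tau x) =
    ((tau (face X 0 x))^-1 * tau (face X 1 x))%g;
  tau_face : forall n k (x : X n.+2), (0 < k <= n.+1)%N ->
    gface G k (tau x) = tau (face X k.+1 x);
  tau_deg : forall n k (x : X n.+1), (k <= n)%N ->
    gdeg G k (tau x) = tau (deg X k.+1 x);
  tau_deg0 : forall n (x : X n), tau (deg X 0 x) = 1%g
}.
Arguments tau {X G} t {n} x : rename.

Definition sigma X G (t : twisting X G) n (x : X n.+1) : gobj G n :=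
  ((tau t x)^-1)%g.

Definition sprod (A B : sset) : sset.
Proof.
exists (fun n => (A n * B n)%type)
       (fun n i z => (face A i z.1, face B i z.2))
       (fun n i z => (deg A i z.1, deg B i z.2)).
have [a1 a2 a3 a4 a5 a6] := sset_laws A.
have [b1 b2 b3 b4 b5 b6] := sset_laws B.
split=> [n i j [x y] h|n i j [x y] h|n j [x y] h|n j [x y] h
        |n i j [x y] h|n i j [x y] h] /=.
- by rewrite a1 // b1.
- by rewrite a2 // b2.
- by rewrite a3 // b3.
- by rewrite a4 // b4.
- by rewrite a5 // b5.
- by rewrite a6 // b6.
Defined.

Definition twprod (X : sset) (G : sgroup) (t : twisting X G) (F : gspace G) :
  sset.
Proof.
exists (fun n => (X n * F n)%type)
       (fun n i z => (face X i z.1,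
          if i is 0 then act F (tau t z.1) (face F 0 z.2) else face F i z.2))
       (fun n i z => (deg X i z.1, deg F i z.2)).
have [a1 a2 a3 a4 a5 a6] := sset_laws X.
have [b1 b2 b3 b4 b5 b6] := sset_laws F.
split=> [n i j [x y] h|n i j [x y] h|n j [x y] h|n j [x y] h
        |n i j [x y] h|n i j [x y] h] /=.
- rewrite a1 //; congr pair; case: i j h => [|i] [|[|j]] //= h; last first.
  + by rewrite b1.
  + rewrite act_face // b1 //; congr (act F _ _).
    by rewrite tau_face //; lia.
  + rewrite act_face // tau_face0 b1 // -actM; congr (act F _ _).
    by rewrite mulgA mulgV mul1g.
- rewrite a2 //; congr pair; case: i j h => [|i] [|j] //= h; last by rewrite b2.
  by rewrite -tau_deg // b2 //= act_deg.
- by rewrite a3 //; case: j h => [|j] h /=; rewrite ?b3 ?tau_deg0 ?act1.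
- by rewrite a4 // b4.
- rewrite a5 //; congr pair; case: i h => [|[|i]] //= h; by rewrite b5.
- by rewrite a6 // b6.
Defined.

(* A formal simplicial operator is a composition of faces and degeneracies,
   written as usual: the rightmost letter is applied first. *)
Inductive sletter := Face of nat | Deg of nat.
Definition soper := seq sletter.

Definition derived (w : soper) : soper :=
  [seq match g with Face i => Face i.+1 | Deg i => Deg i.+1 end | g <- w].

(* The dimension of the image under [w] of a simplex of dimension [m]. *)
Fixpoint sdim (w : soper) (m : nat) : nat :=
  match w with
  | [::] => m
  | Face _ :: w' => (sdim w' m).-1
  | Deg _ :: w' => (sdim w' m).+1
  end.

(* All letters of [w] have meaningful indices when [w] is applied in dimension
   [m]; in particular the dummy value of [face_or_id] for n = 0 is not used. *)
Fixpoint svalid (w : soper) (m : nat) : bool :=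
  match w with
  | [::] => true
  | Face i :: w' => [&& svalid w' m, 0 < sdim w' m & i <= sdim w' m]%N
  | Deg i :: w' => svalid w' m && (i <= sdim w' m)%N
  end.

Definition face_or_id (X : sset) (i n : nat) : X n -> X n.-1 :=
  if n is n'.+1 then face X i else id.

Fixpoint sact (X : sset) (w : soper) m (x : X m) : X (sdim w m) :=
  match w return X (sdim w m) with
  | [::] => x
  | Face i :: w' => face_or_id i (sact w' x)
  | Deg i :: w' => deg X i (sact w' x)
  end.

Definition scast (X : sset) m n (e : m = n) (x : X m) : X n := ecast n (X n) e x.

(* The index set S_n; here the entry i_s has position s - 1 : 'I_n. *)
Definition szS (n : nat) : finType := {dffun forall s : 'I_n, 'I_(n - s)}.

Definition szseq n (i : szS n) : seq nat := [seq (i s : nat) | s <- enum 'I_n].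
Definition szsize n (i : szS n) : nat := (\sum_(s < n) i s)%N.

Fixpoint Dop (i : seq nat) (k : nat) : soper :=
  match i with
  | [::] => [::]
  | i1 :: i' =>
      if (k < i1)%N then derived (Dop i' k) ++ [:: Deg 0; Face (i1 - k)]
      else if k == i1 then derived (Dop i' k)
      else derived (Dop i' k.-1) ++ [:: Deg 0]
  end.

Lemma sdim_cat w1 w2 m : sdim (w1 ++ w2) m = sdim w1 (sdim w2 m).
Proof. by elim: w1 => //= -[i|i] w1 ->. Qed.

Lemma svalid_cat w1 w2 m :
  svalid (w1 ++ w2) m = svalid w2 m && svalid w1 (sdim w2 m).
Proof.
by elim: w1 => [|[i|i] w1 IH] /=; rewrite ?andbT // IH sdim_cat !andbA.
Qed.

Lemma derived_valid w m : svalid w m ->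
  svalid (derived w) m.+1 && (sdim (derived w) m.+1 == (sdim w m).+1).
Proof.
elim: w => [|[i|i] w IH] /=; first by rewrite eqxx.
- by case/and3P=> /IH/andP[-> /eqP->] h1 h2 /=; lia.
- by case/andP=> /IH/andP[-> /eqP->] h /=; lia.
Qed.

Lemma Dop_valid_seq (i : seq nat) k m :
  (forall s, s < size i -> nth 0 i s < size i - s)%N ->
  (k <= size i)%N -> (size i <= m + k)%N ->
  svalid (Dop i k) m && (sdim (Dop i k) m == m + k)%N.
Proof.
elim: i k m => [|i1 i IH] k m ilt kn nm.
  by move: kn; rewrite /= leqn0 => /eqP->; rewrite addn0 eqxx.
have i1n : (i1 <= size i)%N by have /= := ilt 0%N isT; lia.
have {}ilt s : (s < size i -> nth 0 i s < size i - s)%N.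
  by move=> h; have := ilt s.+1 h.
rewrite /= in kn nm *; case: ltnP => ki1.
  case: m nm => [|m] nm; first by lia.
  have /(_ _ _)/andP[| |v /eqP e] := IH k m ilt; [by lia | by lia |].
  have /andP[v' /eqP e'] := derived_valid v.
  by rewrite svalid_cat sdim_cat /= v' e' e; lia.
case: eqP => [ki1E|ki1N].
  case: m nm => [|m] nm; first by lia.
  have /(_ _ _)/andP[| |v /eqP e] := IH k m ilt; [by lia | by lia |].
  by have /andP[-> /eqP ->] := derived_valid v; rewrite e addSn eqxx.
have /(_ _ _)/andP[| |v /eqP e] := IH k.-1 m ilt; [by lia | by lia |].
have /andP[v' /eqP e'] := derived_valid v.
by rewrite svalid_cat sdim_cat /= v' e' e; lia.
Qed.

Lemma Dop_valid n (i : szS n) k m : (k <= n)%N -> (n <= m + k)%N ->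
  svalid (Dop (szseq i) k) m && (sdim (Dop (szseq i) k) m == m + k)%N.
Proof.
have sz : size (szseq i) = n by rewrite size_map size_enum_ord.
move=> kn nm; apply: Dop_valid_seq; rewrite sz // => s sn.
rewrite (nth_map (Ordinal sn)) ?size_enum_ord //.
by rewrite -[X in (_ < n - X)%N](@nth_enum_ord n (Ordinal sn)) ?ltn_ord.
Qed.

Lemma sdim_Dop n (i : szS n) k m (e : (m + k = n)%N) :
  sdim (Dop (szseq i) k) m = n.
Proof.
have kn : (k <= n)%N by rewrite -e leq_addl.
by have /andP[_ /eqP ->] := @Dop_valid n i k m kn (eq_leq (esym e)).
Qed.

(* D_{i,k} on simplices of dimension m = n - k, the only case used below. *)
Definition szD (X : sset) n (i : szS n) k m (e : (m + k = n)%N) (x : X m) :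
  X n := scast (sdim_Dop i e) (sact (Dop (szseq i) k) x).

(* The iterate of the face map 0 of order k, for k <= n. *)
Fixpoint face0_iter (X : sset) (n : nat) : X n.+1 -> forall k, X (n - k).+1 :=
  match n return X n.+1 -> forall k, X (n - k).+1 with
  | 0 => fun x _ => x
  | n'.+1 => fun x k =>
      match k return X (n'.+1 - k).+1 with
      | 0 => x
      | k'.+1 => face0_iter (face X 0 x) k'
      end
  end.

Lemma sub_ordK n (k : 'I_n.+1) : (n - k + k = n)%N.
Proof. by rewrite subnK // -ltnS. Qed.

Lemma sub_ordSK n (k : 'I_n.+1) : (n - k + k.+1 = n.+1)%N.
Proof. by rewrite addnS sub_ordK. Qed.

Definition Sz (X : sset) (G : sgroup) (t : twisting X G) n (i : szS n)
    (x : X n.+1) : gobj G n :=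
  (\prod_(k < n.+1)
     (szD (X := G) i (sub_ordK k) (sigma t (face0_iter x k)) : gobj G n))%g.

Definition Szhat (X : sset) (G : sgroup) (t : twisting X G) n :
    szS n -> X n -> twprod t (gspace_self G) n :=
  match n return szS n -> X n -> twprod t (gspace_self G) n with
  | 0 => fun _ x => (x, 1%g)
  | n'.+1 => fun i x =>
     (szD i (addn0 n'.+1) x,
      (\prod_(k < n'.+1)
         (szD (X := G) i (sub_ordSK k) (sigma t (face0_iter x k))
            : gobj G n'.+1))%g)
  end.

(* The free k-module on K.  The library only provides the k-module structure of
   {malg k[K]} for nonzero rings, and the zero ring is allowed here. *)
Definition chain (k : comPzRingType) (K : choiceType) : Type := {malg k[K]}.

Section Chain.
Variables (k : comPzRingType) (K : choiceType).
Local Notation chain := (chain k K).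

HB.instance Definition _ := GRing.Zmodule.copy chain {malg k[K]}.

Definition chain_scale (a : k) (c : chain) : chain :=
  \sum_(x <- msupp c) << a * c@_x *g x >>.

Lemma chain_scaleE a c x : (chain_scale a c)@_x = a * c@_x.
Proof.
rewrite {2}[c]monalgE !raddf_sum mulr_sumr.
by apply/eq_bigr=> /= y _; rewrite !mcoeffU mulrnAr.
Qed.

Fact chain_scaleA a b c : chain_scale a (chain_scale b c) = chain_scale (a * b) c.
Proof. by apply/malgP=> x; rewrite !chain_scaleE mulrA. Qed.

Fact chain_scale1 : left_id 1 chain_scale.
Proof. by move=> c; apply/malgP=> x; rewrite chain_scaleE mul1r. Qed.

Fact chain_scaleDr : right_distributive chain_scale +%R.
Proof.
by move=> a c c'; apply/malgP=> x; rewrite !(mcoeffD, chain_scaleE) mulrDr.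
Qed.

Fact chain_scaleDl c : {morph chain_scale^~ c : a b / a + b}.
Proof.
by move=> a b; apply/malgP=> x; rewrite !(mcoeffD, chain_scaleE) mulrDl.
Qed.

HB.instance Definition _ := GRing.Zmodule_isLmodule.Build k chain
  chain_scaleA chain_scale1 chain_scaleDr chain_scaleDl.

Definition gen (x : K) : chain := << 1 *g x >>.

Lemma chain_expand (c : chain) : c = \sum_(x <- msupp c) c@_x *: gen x.
Proof.
rewrite {1}[c]monalgE; apply: eq_bigr => x _; apply/malgP => y.
by rewrite chain_scaleE !mcoeffU mulrnAr mulr1.
Qed.

Definition linext (V : lmodType k) (f : K -> V) (c : chain) : V :=
  \sum_(x <- msupp c) c@_x *: f x.

End Chain.
Arguments gen {k K} x.

Section LinExt.
Variables (k : comPzRingType) (K : choiceType) (V : lmodType k) (f : K -> V).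

Lemma linext_sub (D : {fset K}%fset) (c : chain k K) : fsubset (msupp c) D ->
  linext f c = \sum_(x <- D) c@_x *: f x.
Proof.
move=> /fsubsetP sub; apply: big_fset_incl; first exact/fsubsetP.
by move=> x _ /mcoeff_outdom ->; rewrite scale0r.
Qed.

Lemma linext_gen x : linext f (gen x) = f x.
Proof.
by rewrite (linext_sub (msuppU_le)) big_seq_fset1 mcoeffUU scale1r.
Qed.

Fact linext_is_linear : linear (linext f).
Proof.
move=> a c c'; pose D := fsetU (msupp (a *: c + c')) (fsetU (msupp c) (msupp c')).
rewrite !(@linext_sub D) ?scaler_sumr -?big_split /=.
- apply: eq_bigr => x _.
  by rewrite mcoeffD chain_scaleE scalerDl scalerA.
- by apply/fsubsetP => x; rewrite !inE => ->; rewrite !orbT.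
- by apply/fsubsetP => x; rewrite !inE => ->; rewrite !orbT.
- by apply/fsubsetP => x; rewrite !inE => ->.
Qed.

HB.instance Definition _ := GRing.isLinear.Build k (chain k K) V *:%R (linext f)
  linext_is_linear.

End LinExt.

Section Normalized.
Variables (k : comPzRingType) (K : choiceType) (D : K -> Prop).

Definition spanned (c : chain k K) : Prop :=
  exists s : seq (k * K),
    (forall a, a \in s -> D a.2) /\ c = \sum_(a <- s) a.1 *: gen a.2.

Lemma spanned0 : spanned 0.
Proof. by exists [::]; rewrite big_nil. Qed.

Lemma spannedD c c' : spanned c -> spanned c' -> spanned (c + c').
Proof.
move=> [s [Ds ->]] [s' [Ds' ->]]; exists (s ++ s'); rewrite big_cat; split=> // a.
by rewrite mem_cat => /orP[/Ds|/Ds'].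
Qed.

Lemma spannedZ b c : spanned c -> spanned (b *: c).
Proof.
move=> [s [Ds ->]]; exists [seq (b * a.1, a.2) | a <- s]; split.
  by move=> _ /mapP[a /Ds Da ->].
by rewrite scaler_sumr big_map; apply: eq_bigr => a _; rewrite scalerA.
Qed.

Lemma spannedN c : spanned c -> spanned (- c).
Proof. by rewrite -scaleN1r; apply: spannedZ. Qed.

Definition nequiv : rel (chain k K) := fun c c' => `[< spanned (c - c') >].

Fact nequiv_refl : reflexive nequiv.
Proof. by move=> c; apply/asboolP; rewrite subrr; apply: spanned0. Qed.

Fact nequiv_sym : symmetric nequiv.
Proof.
by move=> c c'; apply/asboolP/asboolP => /spannedN; rewrite opprB.
Qed.

Fact nequiv_trans : transitive nequiv.
Proof.
move=> b a c /asboolP ab /asboolP bc; apply/asboolP.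
by have := spannedD ab bc; rewrite addrA subrK.
Qed.

Canonical nequiv_equiv := EquivRel nequiv nequiv_refl nequiv_sym nequiv_trans.
Canonical nequiv_encModRel := defaultEncModRel nequiv.

Definition nchain : Type := {eq_quot nequiv_encModRel}.

HB.instance Definition _ : EqQuotient _ nequiv_encModRel nchain :=
  EqQuotient.on nchain.
HB.instance Definition _ := Choice.on nchain.

Definition npi (c : chain k K) : nchain := \pi_nchain c.

Lemma npi_eq c c' : npi c = npi c' <-> spanned (c - c').
Proof.
by split=> [/eqquotP/asboolP//|h]; apply/eqquotP/asboolP.
Qed.

Lemma npi_repr (x : nchain) : npi (repr x) = x.
Proof. exact: reprK. Qed.

Definition nadd (x y : nchain) : nchain := npi (repr x + repr y).
Definition nopp (x : nchain) : nchain := npi (- repr x).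
Definition nscale (a : k) (x : nchain) : nchain := npi (a *: repr x).

Lemma repr_npi c : spanned (repr (npi c) - c).
Proof. by apply/npi_eq; rewrite npi_repr. Qed.

Lemma npiD c c' : nadd (npi c) (npi c') = npi (c + c').
Proof.
by apply/npi_eq; rewrite opprD addrACA; apply: spannedD; apply: repr_npi.
Qed.

Lemma npiN c : nopp (npi c) = npi (- c).
Proof. by apply/npi_eq; rewrite -opprD; apply/spannedN/repr_npi. Qed.

Lemma npiZ a c : nscale a (npi c) = npi (a *: c).
Proof. by apply/npi_eq; rewrite -scalerBr; apply/spannedZ/repr_npi. Qed.

Fact naddA : associative nadd.
Proof.
by move=> x y z; rewrite -(npi_repr x) -(npi_repr y) -(npi_repr z) !npiD addrA.
Qed.

Fact naddC : commutative nadd.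
Proof. by move=> x y; rewrite -(npi_repr x) -(npi_repr y) !npiD addrC. Qed.

Fact nadd0 : left_id (npi 0) nadd.
Proof. by move=> x; rewrite -(npi_repr x) npiD add0r. Qed.

Fact naddN : left_inverse (npi 0) nopp nadd.
Proof. by move=> x; rewrite -(npi_repr x) npiN npiD addNr. Qed.

HB.instance Definition _ := GRing.isZmodule.Build nchain naddA naddC nadd0 naddN.

Fact nscaleA a b x : nscale a (nscale b x) = nscale (a * b) x.
Proof. by rewrite -(npi_repr x) !npiZ scalerA. Qed.

Fact nscale1 : left_id 1 nscale.
Proof. by move=> x; rewrite -(npi_repr x) npiZ scale1r. Qed.

Fact nscaleDr : right_distributive nscale +%R.
Proof.
have addE (u v : nchain) : u + v = nadd u v by [].
move=> a x y; rewrite -(npi_repr x) -(npi_repr y) !addE.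
by rewrite npiD !npiZ npiD scalerDr.
Qed.

Fact nscaleDl x : {morph nscale^~ x : a b / a + b}.
Proof.
have addE (u v : nchain) : u + v = nadd u v by [].
by move=> a b; rewrite addE -(npi_repr x) !npiZ npiD scalerDl.
Qed.

HB.instance Definition _ := GRing.Zmodule_isLmodule.Build k nchain
  nscaleA nscale1 nscaleDr nscaleDl.

Fact npi_is_linear : linear npi.
Proof.
by move=> a c c'; rewrite -[LHS]/(npi (a *: c + c')) -npiD -npiZ.
Qed.

HB.instance Definition _ := GRing.isLinear.Build k (chain k K) nchain *:%R npi
  npi_is_linear.

Lemma npi_eq0 c : npi c = 0 <-> spanned c.
Proof. by rewrite -[c in spanned c]subr0; apply: npi_eq. Qed.

End Normalized.

Definition degenerate (X : sset) (n : nat) : X n -> Prop :=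
  match n return X n -> Prop with
  | 0 => fun _ => False
  | m.+1 => fun x => exists i (y : X m), (i <= m)%N /\ x = deg X i y
  end.

Definition tdegenerate (X Y : sset) n m (z : X n * Y m) : Prop :=
  degenerate z.1 \/ degenerate z.2.

(* [tchains] is the component of bidegree (n, m) of the tensor product of
   non-normalized chains, identified with the free module on X_n x Y_m. *)
Definition chains k (X : sset) n := chain k (X n).
Definition tchains k (X Y : sset) n m := chain k (X n * Y m)%type.

Definition nchains k (X : sset) n := nchain k (@degenerate X n).
Definition ntchains k (X Y : sset) n m := nchain k (@tdegenerate X Y n m).

(* The component of t in degree n, with values in degree n - 1.  It vanishes
   for n = 0, where its target is 0 and [n.-1] is a dummy. *)
Definition t_simplex k (X : sset) (G : sgroup) (t : twisting X G) (n : nat) :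
    X n -> chain k (G n.-1) :=
  match n return X n -> chain k (G n.-1) with
  | 0 => fun _ => 0
  | 1 => fun x => gen (sigma t x) - gen 1%g
  | m.+2 => fun x =>
      \sum_(i : szS m.+1) (-1) ^+ szsize i *: gen (Sz t i x)
  end.

Definition szt k (X : sset) (G : sgroup) (t : twisting X G) n :
    chains k X n -> chains k G n.-1 := linext (@t_simplex k X G t n).

HB.instance Definition _ k X G t n := GRing.Linear.copy (@szt k X G t n)
  (linext (@t_simplex k X G t n)).

(* A (p, q)-shuffle (mu, nu) is given by mu, with nu its complement. *)
Definition shuffle p q := {mu : {set 'I_(p + q)} | #|mu| == p}.

Definition degs N (B : {set 'I_N}) : soper :=
  [seq Deg (j : 'I_N) | j <- rev (enum B)].

Lemma sdim_degs N (B : {set 'I_N}) m : sdim (degs B) m = (#|B| + m)%N.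
Proof.
rewrite cardE -size_rev /degs.
by elim: (rev _) => //= j s ->.
Qed.

Lemma sdim_nu p q (u : shuffle p q) : sdim (degs (~: val u)) p = (p + q)%N.
Proof.
rewrite sdim_degs; have := cardsC (val u).
by rewrite (eqP (valP u)) card_ord addnC.
Qed.

Lemma sdim_mu p q (u : shuffle p q) : sdim (degs (val u)) q = (p + q)%N.
Proof. by rewrite sdim_degs (eqP (valP u)). Qed.

(* The exponent of the sign of the permutation (mu, nu): its inversions. *)
Definition shuffle_inv p q (u : shuffle p q) : nat :=
  #|[set ij : 'I_(p + q) * 'I_(p + q) |
      [&& ij.1 \in val u, ij.2 \notin val u & (ij.2 < ij.1)%N]]|.

Definition EZ_simplex k (A B : sset) p q (z : A p * B q) :
    chain k (sprod A B (p + q)%N) :=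
  \sum_(u : shuffle p q) (-1) ^+ shuffle_inv u *:
    gen (scast (sdim_nu u) (sact (degs (~: val u)) z.1),
         scast (sdim_mu u) (sact (degs (val u)) z.2)).

Definition EZ k (A B : sset) p q :
    tchains k A B p q -> chains k (sprod A B) (p + q)%N :=
  linext (@EZ_simplex k A B p q).

(* (id_X, mu_F) : (X x_t G) x F -> X x_t F *)
Definition id_act (X : sset) (G : sgroup) (t : twisting X G) (F : gspace G) n
    (z : sprod (twprod t (gspace_self G)) F n) : twprod t F n :=
  (z.1.1, act F (z.1.2 : gobj G n) z.2).

Definition pushforward k (K L : choiceType) (f : K -> L) : chain k K -> chain k L :=
  linext (fun x => gen (f x)).

Definition psi_simplex k (X : sset) (G : sgroup) (t : twisting X G)
    (F : gspace G) n m (z : X n * F m) : chain k (twprod t F (n + m)%N) :=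
  \sum_(i : szS n) (-1) ^+ szsize i *:
    pushforward (@id_act X G t F (n + m)%N) (EZ (gen (Szhat t i z.1, z.2))).

Definition psi k (X : sset) (G : sgroup) (t : twisting X G) (F : gspace G) n m :
    tchains k X F n m -> chains k (twprod t F) (n + m)%N :=
  linext (@psi_simplex k X G t F n m).

HB.instance Definition _ k X G t F n m := GRing.Linear.copy (@psi k X G t F n m)
  (linext (@psi_simplex k X G t F n m)).

(* Main.v *)
(* An index i in S_n is the Lehmer code of an order of deletion of the vertices
   0, ..., n - 1 of the n-simplex, and D_{i,k} is induced by the monotone map
   which sends j to the smallest vertex >= k remaining after j deletions
   (shifted by k).  Exchanging the deletion times of p and p + 1 reverses the sign of i
   and is invisible once the vertices p and p + 1 are identified, so the terms
   for a degenerate simplex cancel in pairs.  The exceptions are the first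
   degeneracy, for Sz only, where the vertex 0 plays no role, and the last one,
   where the vertex n, which is never deleted, is identified with its
   predecessor: then nothing changes when 0, respectively n - 1, is deleted, and
   each term is degenerate.  For psi one also uses that each term of the shuffle
   map is degenerate as soon as one of its arguments is. *)
Require Import Defs.
From HB Require Import structures.
From mathcomp Require Import all_boot all_algebra.
From mathcomp Require Import zify.

Set Implicit Arguments.
Unset Strict Implicit.
Unset Printing Implicit Defensive.

Import GRing.Theory.
Local Open Scope ring_scope.

(** * Simplices of all dimensions, and the decalage *)

(** Packing a simplex with its dimension lets operators be compared without casts between
    propositionally equal dimensions; [simp_inj] returns to a fixed dimension. *)
Definition tot (X : sset) : Type := {n : nat & X n}.

Definition simp (X : sset) n (x : X n) : tot X := Tagged (fun n => X n : Type) x.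

Definition tface X i (u : tot X) : tot X := simp (face_or_id i (tagged u)).

Definition tdeg X i (u : tot X) : tot X := simp (deg X i (tagged u)).

Definition tletter X (g : sletter) : tot X -> tot X :=
  match g with Face i => tface i | Deg i => tdeg i end.

Definition tact X (w : soper) (u : tot X) : tot X := foldr (@tletter X) u w.

Lemma simp_inj (X : sset) n : injective (@simp X n).
Proof. by move=> x y; apply: eq_from_Tagged. Qed.

Lemma simpP X n (u : tot X) : tag u = n -> exists x : X n, u = simp x.
Proof. by case: u => m x /= <-; exists x. Qed.

Lemma simp_scast (X : sset) m n (e : m = n) (x : X m) :
  simp (scast e x) = simp x.
Proof. by case: n / e. Qed.

Lemma tact_simp (X : sset) w m (x : X m) : tact w (simp x) = simp (sact w x).
Proof. by elim: w => //= -[i|i] w ->. Qed.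

Lemma tag_tact X w (u : tot X) : tag (tact w u) = sdim w (tag u).
Proof. by elim: w => //= -[i|i] w /= ->. Qed.

Lemma tact_cat X w1 w2 (u : tot X) : tact (w1 ++ w2) u = tact w1 (tact w2 u).
Proof. exact: foldr_cat. Qed.

Section Laws.
Variable X : sset.
Implicit Types u : tot X.

Lemma tds_lt i j u : (i < j <= tag u)%N ->
  tface i (tdeg j u) = tdeg j.-1 (tface i u).
Proof.
case: u => -[|n] x /= h; first by lia.
by rewrite /tface /tdeg /= (law_ds_lt (sset_laws X)).
Qed.

Lemma tds_id j u : (j <= tag u)%N -> tface j (tdeg j u) = u.
Proof.
case: u => n x /= h.
by rewrite /tface /tdeg /= (law_ds_id (sset_laws X)).
Qed.

Lemma tds_idS j u : (j <= tag u)%N -> tface j.+1 (tdeg j u) = u.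
Proof.
case: u => n x /= h.
by rewrite /tface /tdeg /= (law_ds_idS (sset_laws X)).
Qed.

Lemma tds_gt i j u : (j.+1 < i <= (tag u).+1)%N ->
  tface i (tdeg j u) = tdeg j (tface i.-1 u).
Proof.
case: u => -[|n] x /= h; first by lia.
by rewrite /tface /tdeg /= (law_ds_gt (sset_laws X)).
Qed.

Lemma tss i j u : (i <= j <= tag u)%N ->
  tdeg i (tdeg j u) = tdeg j.+1 (tdeg i u).
Proof.
case: u => n x /= h.
by rewrite /tface /tdeg /= (law_ss (sset_laws X)).
Qed.

End Laws.

(* The decalage: operators on it are the derived operators on [X]. *)
Definition dec (X : sset) : sset.
Proof.
exists (fun n => X n.+1) (fun n i x => face X i.+1 x)
       (fun n i x => deg X i.+1 x).
have [a1 a2 a3 a4 a5 a6] := sset_laws X.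
split=> [n i j x h|n i j x h|n j x h|n j x h|n i j x h|n i j x h].
- by rewrite a1 ?ltnS //; case: j h.
- by rewrite a2 ?ltnS //; case: j h.
- by rewrite a3.
- by rewrite a4.
- by rewrite a5 ?ltnS //; case: i h.
- by rewrite a6.
Defined.

Definition undec X (v : tot (dec X)) : tot X :=
  @simp X (tag v).+1 (tagged v).

Lemma undecP X (u : tot X) n : tag u = n.+1 ->
  exists2 v : tot (dec X), tag v = n & u = undec v.
Proof.
move=> /simpP[x ->]; by exists (@simp (dec X) n x).
Qed.

(** Validity excludes a face in dimension 0 of [dec X]: there [face_or_id] is the identity, while
    the derived letter is a genuine face of a 1-simplex of [X]. *)
Lemma tact_derived X w (v : tot (dec X)) : svalid w (tag v) ->
  tact (derived w) (undec v) = undec (tact w v).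
Proof.
elim: w => //= -[i|i] w IH /=; last by move=> /andP[/IH-> _].
case/and3P=> /IH-> + _.
by case: (tact w v) (tag_tact w v) => -[|n] x /= <-.
Qed.

Lemma tdeg_undec X i (v : tot (dec X)) :
  tdeg i.+1 (undec v) = undec (tdeg i v).
Proof. by []. Qed.

(** * Index sequences as orders of deletion *)

Fixpoint szok (i : seq nat) : bool :=
  if i is a :: i' then (a <= size i')%N && szok i' else true.

Lemma szok_nth i : szok i <->
  (forall s, s < size i -> nth 0 i s < size i - s)%N.
Proof.
elim: i => [|a i IH] //=; split.
  by case/andP=> ai /IH h [|s] //= /h.
move=> h; rewrite -ltnS (h 0%N) //=; apply/IH => s si; exact: (h s.+1).
Qed.

Lemma Dop_ok i k m : szok i -> (m + k)%N = size i -> svalid (Dop i k) m.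
Proof.
move=> /szok_nth h e.
by have /andP[] : svalid (Dop i k) m && (sdim (Dop i k) m == m + k)%N;
  [apply: Dop_valid_seq => //; lia|].
Qed.

Lemma sdim_Dop_ok i k m : szok i -> (m + k)%N = size i ->
  sdim (Dop i k) m = size i.
Proof.
move=> /szok_nth h e.
by have /andP[_ /eqP->] : svalid (Dop i k) m && (sdim (Dop i k) m == m + k)%N;
  [apply: Dop_valid_seq => //; lia|].
Qed.

(* Read [i] as an order of deletion of the vertices 0, ..., n - 1: at each step
   the remaining vertex of rank i_s is deleted.  [szswap p i] exchanges the
   roles of the vertices p and p + 1, and [szpos p i] is the step at which the
   vertex p is deleted. *)
Fixpoint szswap (p : nat) (i : seq nat) : seq nat :=
  match i with
  | [::] => [::]
  | a :: i' =>
      if (a < p)%N then a :: szswap p.-1 i'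
      else if a == p then p.+1 :: i'
      else if a == p.+1 then p :: i'
      else a :: szswap p i'
  end.

Fixpoint szpos (p : nat) (i : seq nat) : nat :=
  match i with
  | [::] => 0
  | a :: i' =>
      if (a < p)%N then (szpos p.-1 i').+1
      else if a == p then 0%N else (szpos p i').+1
  end.

Lemma size_szswap p i : size (szswap p i) = size i.
Proof.
elim: i p => //= a i IH p; case: ltnP => _ /=; first by rewrite IH.
by case: eqP => // _; case: eqP => //= _; rewrite IH.
Qed.

Lemma szok_szswap p i : szok i -> (p.+1 < size i)%N -> szok (szswap p i).
Proof.
elim: i p => //= a i IH p /andP[ai oki] pi.
case: ltnP => ap /=; first by rewrite size_szswap ai IH //; lia.
case: eqP => [_|apN] /=; first by rewrite oki andbT; lia.
case: eqP => [_|apSN] /=; first by rewrite oki andbT; lia.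
by rewrite size_szswap ai IH //; lia.
Qed.

Lemma szswapK p : involutive (szswap p).
Proof.
move=> i; elim: i p => //= a i IH p.
case: ltnP => ap /=; first by rewrite ap IH.
case: eqP => [->|apN] /=; first by rewrite ltnNge leqnSn /= gtn_eqF // eqxx.
case: eqP => [->|apSN] /=; first by rewrite ltnn eqxx.
by rewrite ltnNge ap /= IH; do 2 case: eqP => //.
Qed.

(** Only the entry at which the first of the vertices p, p + 1 is deleted changes, by one:
    afterwards the remaining ranks are the same. The bound on p ensures that this step occurs. *)
Lemma odd_szswap p i : szok i -> (p.+1 < size i)%N ->
  odd (sumn (szswap p i)) = ~~ odd (sumn i).
Proof.
elim: i p => //= a i IH p /andP[ai oki] pi.
case: ltnP => ap /=; first by rewrite !oddD IH ?addbN //; lia.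
case: eqP => [->|apN] /=; first by [].
case: eqP => [->|apSN] /=; first by rewrite negbK.
by rewrite !oddD IH ?addbN //; lia.
Qed.

Lemma szpos_lt p i : szok i -> (p < size i)%N -> (szpos p i < size i)%N.
Proof.
elim: i p => //= a i IH p /andP[ai oki] pi.
case: (ltnP a p) => ap; first by rewrite ltnS IH //; lia.
by case: eqP => // apN; apply: IH => //; lia.
Qed.

(** * The operators D on degenerate simplices *)

Lemma Dop_cons X a i k (u : tot X) : tact (Dop (a :: i) k) u =
  if (k < a)%N then tact (derived (Dop i k)) (tdeg 0 (tface (a - k) u))
  else if k == a then tact (derived (Dop i k)) u
  else tact (derived (Dop i k.-1)) (tdeg 0 u).
Proof. by rewrite /=; case: ltnP => // _; [|case: eqP => // _]; rewrite tact_cat. Qed.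

(** After the shift by k, the degeneracy identifies the vertices p and p + 1. It moves past the
    leading letters until one of these vertices is deleted; there both faces, of index p - k and p +
    1 - k, cancel it. *)
Lemma Dop_swap_lo i p k m (X : sset) (u : tot X) :
  szok i -> (p.+1 < size i)%N -> (k <= p)%N -> (m.+1 + k)%N = size i ->
  tag u = m ->
  tact (Dop i k) (tdeg (p - k) u) = tact (Dop (szswap p i) k) (tdeg (p - k) u).
Proof.
elim: i p k m X u => //= a i IH p k m X u /andP[ai oki] pi kp e um.
(* The induction hypothesis is used on the decalage, where a derived operator becomes the original
   one. *)
have lift j q r (v : tot X) : (q.+1 < size i)%N -> (j <= q)%N ->
    (r.+1 + j)%N = size i -> tag v = r.+1 ->
    tact (derived (Dop i j)) (tdeg (q - j).+1 v) =
    tact (derived (Dop (szswap q i) j)) (tdeg (q - j).+1 v).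
  move=> qi jq er /undecP[v' v'r ->]; rewrite tdeg_undec.
  have szi := size_szswap q i.
  have oki' := szok_szswap oki qi.
  rewrite !tact_derived ?(IH q j r) //= v'r; apply: Dop_ok => //; lia.
rewrite -/(Dop (a :: i) k) Dop_cons.
case: (ltnP a p) => ap; rewrite ?Dop_cons.
- case: (ltnP k a) => ka.
    rewrite tds_lt; last lia.
    rewrite tss; last by rewrite /=; lia.
    have -> : ((p - k).-1.+1 = (p.-1 - k).+1)%N by lia.
    by apply: (lift _ _ m.-1) => //=; lia.
  case: eqP => [ka'|ka'].
    have -> : ((p - k) = (p.-1 - k).+1)%N by lia.
    by apply: (lift _ _ m.-1) => //=; lia.
  rewrite tss; last lia.
  have -> : ((p - k).+1 = (p.-1 - k.-1).+1)%N by lia.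
  by apply: (lift _ _ m) => //=; lia.
case: (a =P p) => [apE|apN]; rewrite ?Dop_cons.
  case: (ltnP k p) => kp'.
    rewrite {}apE kp' leqW // tds_id; last lia.
    by rewrite subSn // tds_idS //; lia.
  (* For k = p, one side has no leading letters, and on the other the face of index 1 cancels s_0,
     leaving s_0 u on both sides. *)
  have {kp' kp}-> : k = p by lia.
  by rewrite apE ltnn eqxx leqnn subSnn subnn tds_idS.
case: (a =P p.+1) => [apE|apSN]; rewrite ?Dop_cons.
  rewrite apE ltnS kp subSn // tds_idS; last lia.
  case: (ltnP k p) => kp'; first by rewrite tds_id //; lia.
  have -> : k = p by lia.
  by rewrite eqxx subnn.
have ka : (k < a)%N by lia.
rewrite ka tds_gt; last lia.
rewrite tss; last by rewrite /=; lia.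
by apply: (lift _ _ m.-1) => //=; lia.
Qed.

(** D_{i,k} only sees vertices >= k, and both p and p + 1 lie below k. *)
Lemma Dop_swap_hi i p k m (X : sset) (u : tot X) :
  szok i -> (p.+1 < size i)%N -> (p.+1 < k)%N -> (m + k)%N = size i ->
  tag u = m ->
  tact (Dop i k) u = tact (Dop (szswap p i) k) u.
Proof.
elim: i p k m X u => //= a i IH p k m X u /andP[ai oki] pi pk e um.
have lift j q r (v : tot X) : (q.+1 < size i)%N -> (q.+1 < j)%N ->
    (r + j)%N = size i -> tag v = r.+1 ->
    tact (derived (Dop i j)) v = tact (derived (Dop (szswap q i) j)) v.
  move=> qi qj er /undecP[w wr ->].
  have szi := size_szswap q i.
  have oki' := szok_szswap oki qi.
  by rewrite !tact_derived ?(IH q j r) // wr Dop_ok // szi.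
rewrite -/(Dop (a :: i) k) Dop_cons.
case: (ltnP a p) => ap; rewrite ?Dop_cons.
  rewrite ltnNge (_ : a <= k)%N /=; last lia.
  rewrite (_ : k == a = false); last lia.
  by apply: (lift _ _ m) => //=; lia.
case: (a =P p) => [apE|apN]; rewrite ?Dop_cons.
  by rewrite apE !ifN //; lia.
case: (a =P p.+1) => [apE|apSN]; rewrite ?Dop_cons.
  by rewrite apE !ifN //; lia.
case: (ltnP k a) => ka; first by apply: (lift _ _ m.-1) => //=; lia.
case: (k =P a) => ka'; first by apply: (lift _ _ m.-1) => //=; lia.
by apply: (lift _ _ m) => //=; lia.
Qed.

(** A derived operator D' satisfies D' s_0 = s_0 D letter by letter, except at the face of index 0:
    its derived face, of index 1, would cancel s_0. *)
Definition pos_faces (w : soper) : bool :=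
  all (fun g => if g is Face 0 then false else true) w.

Lemma pos_faces_derived w : pos_faces (derived w).
Proof. by elim: w => //= -[]. Qed.

Lemma pos_faces_Dop i k : pos_faces (Dop i k).
Proof.
have catE w1 w2 : pos_faces (w1 ++ w2) = pos_faces w1 && pos_faces w2.
  exact: all_cat.
case: i => //= a i; case: ltnP => ka.
  rewrite catE pos_faces_derived /=.
  have: (a - k != 0)%N by lia.
  by case: (a - k)%N.
by case: eqP => _; rewrite ?catE pos_faces_derived.
Qed.

Lemma tact_derived_deg0 X w (u : tot X) : svalid w (tag u) -> pos_faces w ->
  tact (derived w) (tdeg 0 u) = tdeg 0 (tact w u).
Proof.
elim: w => //= -[[|i]|i] w IH //=.
  case/and3P=> v s0 si f; rewrite IH // tds_gt // tag_tact ltnS //.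
by case/andP=> v si f; rewrite IH // -tss // tag_tact.
Qed.

(** The last two vertices are identified, so deleting vertex n - 1, with n = [size i], repeats a
    value. The resulting index does not depend on k, so all factors of a Szczarba product share
    it. *)
Lemma Dop_last i k m (X : sset) (u : tot X) :
  szok i -> (m.+1 + k)%N = size i -> tag u = m ->
  exists2 v : tot X, (tag v).+1 = size i &
    tact (Dop i k) (tdeg m u) = tdeg (szpos (size i).-1 i) v.
Proof.
elim: i k m X u => //= a i IH k m X u /andP[ai oki] e um.
have lift j r (v : tot X) : (r.+1 + j)%N = size i -> tag v = r.+1 ->
    exists2 v' : tot X, tag v' = size i &
    tact (derived (Dop i j)) (tdeg r.+1 v) =
    tdeg (szpos (size i).-1 i).+1 v'.
  move=> er /undecP[w wr ->]; rewrite tdeg_undec tact_derived; last first.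
    by rewrite /= wr Dop_ok //; lia.
  have [v' v'i ->] := IH j r _ w oki er wr.
  by exists (undec v').
rewrite -/(Dop (a :: i) k) Dop_cons.
case: (ltnP a (size i)) => ap; last first.
  (* This step deletes the last deletable vertex. If k < a, the face cancels s_m and the new s_0
     passes through the derived operator; if k = a, then m = 0 and s_m is already s_0. *)
  have {ap}a_i : a = size i by lia.
  rewrite a_i eqxx; exists (tact (Dop i k) u).
    by rewrite tag_tact sdim_Dop_ok //; lia.
  case: (k =P size i) => ki; last rewrite ifT; last lia.
    have m0 : m = 0%N by lia.
    by rewrite ki ltnn m0 tact_derived_deg0 ?pos_faces_Dop // um Dop_ok //; lia.
  rewrite (_ : (size i - k)%N = m); last lia.
  by rewrite tds_id ?um // tact_derived_deg0 ?pos_faces_Dop // um Dop_ok //; lia.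
case: (ltnP k a) => ka.
  rewrite tds_lt; last lia.
  rewrite tss; last by rewrite /=; lia.
  have -> : (m.-1.+1 = m)%N by lia.
  have := lift k m.-1 (tdeg 0 (tface (a - k) u)).
  rewrite prednK; last lia.
  by move=> /(_ _ _)[||v' <- ->]; [lia|rewrite /=; lia|exists v'].
case: (k =P a) => ka'.
  have := lift k m.-1 u; rewrite prednK; last lia.
  by move=> /(_ _ _)[||v' <- ->]; [lia|rewrite /=; lia|exists v'].
rewrite tss; last lia.
by have /(_ _ _)[||v' <- ->] := lift k.-1 m (tdeg 0 u);
  [lia|rewrite /=; lia|exists v'].
Qed.

(** For k > 0 the vertex 0 lies below k, so its deletion repeats a value, at an index again
    independent of k. *)
Lemma Dop_first i k m (X : sset) (u : tot X) :
  szok i -> (0 < k)%N -> (m + k)%N = size i -> tag u = m ->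
  exists2 v : tot X, (tag v).+1 = size i &
    tact (Dop i k) u = tdeg (szpos 0 i) v.
Proof.
elim: i k m X u => [|a i IH] k m X u; first by rewrite /=; lia.
move=> /andP[ai oki] k0 /= e um.
have lift j r (v : tot X) : (0 < j)%N -> (r + j)%N = size i -> tag v = r.+1 ->
    exists2 v' : tot X, tag v' = size i &
    tact (derived (Dop i j)) v = tdeg (szpos 0 i).+1 v'.
  move=> j0 er /undecP[w wr ->]; rewrite tact_derived; last first.
    by rewrite wr Dop_ok.
  have [v' v'i ->] := IH j r _ w oki j0 er wr.
  by exists (undec v').
rewrite -/(Dop (a :: i) k) Dop_cons.
case: (a =P 0%N) => [->|a0].
  rewrite gtn_eqF // ltn0.
  exists (tact (Dop i k.-1) u); first by rewrite tag_tact sdim_Dop_ok //; lia.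
  by rewrite tact_derived_deg0 ?pos_faces_Dop // um Dop_ok //; lia.
case: (ltnP k a) => ka.
  by have /(_ _ _ _)[|||v' <- ->] :=
    lift k m.-1 (tdeg 0 (tface (a - k) u)); [|lia|rewrite /=; lia|exists v'].
case: (k =P a) => ka'.
  by have /(_ _ _ _)[|||v' <- ->] := lift k m.-1 u; [|lia|lia|exists v'].
by have /(_ _ _ _)[|||v' <- ->] := lift k.-1 m (tdeg 0 u);
   [lia|lia|rewrite /=; lia|exists v'].
Qed.

(** * Neutral elements and products in a simplicial group *)

Section SimplicialGroup.
Variable G : sgroup.

Lemma gdeg1 n i : (i <= n)%N -> @gdeg G n i 1%g = 1%g.
Proof.
move=> ni; apply: (mulgI (@gdeg G n i 1%g)).
by rewrite -gdegM // !mulg1.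
Qed.

Lemma gface1 n i : (i <= n.+1)%N -> @gface G n i 1%g = 1%g.
Proof.
move=> ni; apply: (mulgI (@gface G n i 1%g)).
by rewrite -gfaceM // !mulg1.
Qed.

Lemma gdegV n i (a : G n) : (i <= n)%N -> gdeg G i a^-1%g = (gdeg G i a)^-1%g.
Proof.
move=> ni; apply: (mulgI (gdeg G i a)).
by rewrite -gdegM // !mulgV gdeg1.
Qed.

Definition tone n : tot G := @simp G n (1%g : G n).

Lemma tdeg_one i n : (i <= n)%N -> tdeg i (tone n) = tone n.+1.
Proof. by move=> ni; rewrite /tdeg /tone /= gdeg1. Qed.

Lemma tface_one i n : (i <= n.+1)%N -> tface i (tone n.+1) = tone n.
Proof. by move=> ni; rewrite /tface /tone /= gface1. Qed.

Lemma tact_one w n : svalid w n -> tact w (tone n) = tone (sdim w n).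
Proof.
elim: w => //= -[i|i] w IH /=; last by case/andP=> /IH -> ?; rewrite tdeg_one.
case/and3P=> /IH ->; case: (sdim w n) => // d _ id; exact: tface_one.
Qed.

Lemma tact_Dop_one i k m : szok i -> (m + k)%N = size i ->
  tact (Dop i k) (tone m) = tone (size i).
Proof. by move=> oki e; rewrite tact_one ?sdim_Dop_ok // Dop_ok. Qed.

Lemma prod_gdeg (I : finType) n j (f : I -> G n.+1) : (j <= n)%N ->
  (forall k, exists g, f k = gdeg G j g) ->
  exists g, (\prod_k f k)%g = gdeg G j g.
Proof.
move=> jn fP; apply: (big_ind (fun a => exists g, a = gdeg G j g)) => //.
  by exists 1%g; rewrite gdeg1.
by move=> _ _ [a ->] [b ->]; exists (a * b)%g; rewrite gdegM.
Qed.

End SimplicialGroup.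

(** * Factors of the Szczarba products at a degenerate simplex *)

Lemma tag_iter_face X k (u : tot X) : tag (iter k (tface 0) u) = (tag u - k)%N.
Proof. by elim: k => [|k /= ->]; rewrite ?subn0 // subnS. Qed.

Lemma iter_face_deg X k p (u : tot X) : (k <= p <= tag u)%N ->
  iter k (tface 0) (tdeg p u) = tdeg (p - k) (iter k (tface 0) u).
Proof.
elim: k => [|k IH] h; first by rewrite subn0.
rewrite /= IH; last lia.
by rewrite tds_lt ?tag_iter_face ?subnS //; lia.
Qed.

Lemma iter_face_deg_gt X k p (u : tot X) : (p < k)%N -> (p <= tag u)%N ->
  iter k (tface 0) (tdeg p u) = iter k.-1 (tface 0) u.
Proof.
(* The first p faces lower the degeneracy to s_0, the next one cancels it, and k - 1 - p faces
   remain. *)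
move=> pk pu; have ->: k = (k.-1 - p + p.+1)%N by lia.
rewrite iterD /= iter_face_deg ?leqnn // subnn tds_id //.
by rewrite -iterD; congr iter; lia.
Qed.

Lemma simp_face0_iter (X : sset) n (x : X n.+1) k : (k <= n)%N ->
  simp (face0_iter x k) = iter k (tface 0) (simp x).
Proof.
by elim: n x k => [|n IH] x [|k] // kn; rewrite iterSr /= IH.
Qed.

Section Twisting.
Variables (X : sset) (G : sgroup) (t : twisting X G).

(** A twisting function lives in positive dimensions; the value in dimension 0 is a default
    compatible with [tag_tsig]. *)
Definition tsig (u : tot X) : tot G :=
  match u with
  | existT 0 _ => tone G 0
  | existT n.+1 x => @simp G n (sigma t x)
  end.

Lemma tag_tsig u : tag (tsig u) = (tag u).-1.
Proof. by case: u => -[]. Qed.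

Lemma tsig_deg p u : (p < tag u)%N -> tsig (tdeg p.+1 u) = tdeg p (tsig u).
Proof.
case: u => -[|n] x //= pn.
by rewrite /tdeg /= /sigma -tau_deg // gdegV.
Qed.

Lemma tsig_deg0 u : tsig (tdeg 0 u) = tone G (tag u).
Proof. by rewrite /tdeg /= /sigma tau_deg0 invg1. Qed.

(** The k-th factor at the simplex s_p u, before D is applied. The three lemmas below separate its
    behaviour: degenerate for k < p, neutral for k = p, free of the degeneracy for k > p. *)
Definition tfac k p (u : tot X) : tot G := tsig (iter k (tface 0) (tdeg p u)).

Lemma tfac_lt k p u : (k < p <= tag u)%N ->
  tfac k p u = tdeg (p - k.+1) (tsig (iter k (tface 0) u)).
Proof.
move=> kp; rewrite /tfac iter_face_deg; last lia.
by rewrite -tsig_deg ?tag_iter_face ?subnSK //; lia.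
Qed.

Lemma tfac_id k u : (k <= tag u)%N -> tfac k k u = tone G (tag u - k).
Proof.
by move=> ku; rewrite /tfac iter_face_deg ?leqnn // subnn tsig_deg0 tag_iter_face.
Qed.

Lemma tfac_gt k p u : (p < k)%N -> (p <= tag u)%N ->
  tfac k p u = tsig (iter k.-1 (tface 0) u).
Proof. by move=> pk pu; rewrite /tfac iter_face_deg_gt. Qed.

(** [Sz] uses q = p + 1 and r = k, whereas [Szhat] uses q = p and r = k + 1. For k < q the factor
    identifies the swapped vertices, for k = q it is neutral, and for k > q both vertices lie below
    r. *)
Lemma tfac_swap i p r q k u : szok i -> (p.+1 < size i)%N ->
  (q + r = p.+1 + k)%N -> (tag u + r = size i + k)%N -> (r <= size i)%N ->
  tact (Dop (szswap p i) r) (tfac k q u) = tact (Dop i r) (tfac k q u).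
Proof.
move=> oki pi qk uk ri.
have oks := szok_szswap oki pi; have szs := size_szswap p i.
case: (ltngtP k q) => kq; last first.
- rewrite -kq tfac_id; last lia.
  by rewrite !tact_Dop_one ?szs //; lia.
- rewrite tfac_gt //; last lia.
  rewrite -(Dop_swap_hi (m := size i - r)) // ?tag_tsig ?tag_iter_face; lia.
- rewrite tfac_lt; last lia.
  have -> : (q - k.+1 = p - r)%N by lia.
  rewrite -(Dop_swap_lo (m := (size i - r).-1)) //
    ?tag_tsig ?tag_iter_face; lia.
Qed.

Lemma tfac_last i r k u : szok i -> (0 < size i)%N ->
  (tag u + r = size i + k)%N -> (r <= size i)%N ->
  exists2 v : tot G, (tag v).+1 = size i &
    tact (Dop i r) (tfac k (tag u) u) = tdeg (szpos (size i).-1 i) v.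
Proof.
move=> oki i0 uk ri; case: (ltngtP k (tag u)) => ku; last first.
- rewrite -ku tfac_id; last lia.
  (* The neutral element is degenerate along every index, in particular along the required one. *)
  exists (tone G (size i).-1); first by rewrite /= prednK.
  rewrite tact_Dop_one ?tdeg_one ?prednK //; last lia.
  by have := szpos_lt oki (p := (size i).-1); lia.
- lia.
- rewrite tfac_lt; last lia.
  have -> : (tag u - k.+1 = (size i - r).-1)%N by lia.
  apply: Dop_last => //; rewrite ?tag_tsig ?tag_iter_face; lia.
Qed.

Lemma tfac_first i k u : szok i -> (0 < size i)%N -> tag u = size i ->
  (k <= size i)%N ->
  exists2 v : tot G, (tag v).+1 = size i &
    tact (Dop i k) (tfac k 0 u) = tdeg (szpos 0 i) v.
Proof.
move=> oki i0 uk ki; case: (posnP k) => k0.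
  rewrite k0 tfac_id //; exists (tone G (size i).-1); first by rewrite /= prednK.
  rewrite subn0 tact_Dop_one ?tdeg_one ?prednK //; try lia.
  by have := szpos_lt oki i0; lia.
rewrite tfac_gt //; apply: (@Dop_first _ _ (size i - k)) => //;
  rewrite ?tag_tsig ?tag_iter_face; lia.
Qed.

End Twisting.

(** * The exchange of two vertices on S_n *)

Lemma size_szseq n (i : szS n) : size (szseq i) = n.
Proof. by rewrite size_map size_enum_ord. Qed.

Lemma nth_szseq n (i : szS n) (s : 'I_n) : nth 0%N (szseq i) s = i s.
Proof.
by rewrite (nth_map s) ?size_enum_ord ?nth_ord_enum.
Qed.

Lemma szok_szseq n (i : szS n) : szok (szseq i).
Proof.
apply/szok_nth => s; rewrite size_szseq => sn.
by rewrite (nth_szseq i (Ordinal sn)) (ltn_ord (i (Ordinal sn))).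
Qed.

Lemma sumn_szseq n (i : szS n) : sumn (szseq i) = szsize i.
Proof. by rewrite sumnE big_map big_enum. Qed.

Lemma szseq_inj n : injective (@szseq n).
Proof.
move=> i j eij; apply/ffunP => s; apply: val_inj.
by rewrite /= -!nth_szseq eij.
Qed.

(** The remainder makes the definition total; by [szseq_mk] it changes nothing on an admissible
    sequence. *)
Definition mk_szS n (l : seq nat) : szS n :=
  [ffun s : 'I_n => Ordinal (ltn_pmod (nth 0%N l s)
     (etrans (subn_gt0 s n) (ltn_ord s)))].

Lemma szseq_mk n l : szok l -> size l = n -> szseq (mk_szS n l) = l.
Proof.
move=> /szok_nth okl sl; apply: (@eq_from_nth _ 0%N).
  by rewrite size_szseq.
move=> s; rewrite size_szseq => sn.
rewrite (nth_szseq _ (Ordinal sn)) ffunE /= modn_small //.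
by rewrite -{1}sl okl // sl.
Qed.

Definition swapS n p (i : szS n) : szS n := mk_szS n (szswap p (szseq i)).

Lemma szseq_swap n p (i : szS n) : (p.+1 < n)%N ->
  szseq (swapS p i) = szswap p (szseq i).
Proof.
move=> pn; rewrite szseq_mk ?size_szswap ?size_szseq //.
by rewrite szok_szswap ?size_szseq ?szok_szseq.
Qed.

Lemma swapSK n p : (p.+1 < n)%N -> involutive (@swapS n p).
Proof. by move=> pn i; apply: szseq_inj; rewrite !szseq_swap // szswapK. Qed.

Lemma odd_swapS n p (i : szS n) : (p.+1 < n)%N ->
  odd (szsize (swapS p i)) = ~~ odd (szsize i).
Proof.
move=> pn; rewrite -!sumn_szseq szseq_swap // odd_szswap ?size_szseq //.
exact: szok_szseq.
Qed.

Lemma simp_szD (X : sset) n (i : szS n) k m (e : (m + k = n)%N) (x : X m) :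
  simp (szD i e x) = tact (Dop (szseq i) k) (simp x).
Proof. by rewrite simp_scast tact_simp. Qed.

Lemma simp_deg (X : sset) p n (x : X n) : simp (deg X p x) = tdeg p (simp x).
Proof. by []. Qed.

Lemma simp_degP (X : sset) n j (a : X n.+1) :
  (exists2 v : tot X, (tag v).+1 = n.+1 & simp a = tdeg j v) ->
  exists b, a = deg X j b.
Proof.
by case=> v [/simpP[b ->]]; rewrite -simp_deg => /simp_inj ->; exists b.
Qed.

(** * Szczarba operators on degenerate simplices *)

Section Szczarba.
Variables (X : sset) (G : sgroup) (t : twisting X G).

Lemma simp_Sz_factor n (i : szS n) (p : nat) (y : X n) (k : 'I_n.+1) :
  @simp G n (szD (X := G) i (Defs.sub_ordK k)
    (sigma t (face0_iter (deg X p y) k))) =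
  tact (Dop (szseq i) k) (tfac t k p (simp y)).
Proof.
rewrite simp_szD; congr tact.
by rewrite /tfac -simp_deg -simp_face0_iter // -ltnS.
Qed.

(** The index drops from p + 1 to p because sigma turns s_{p+1} into s_p. *)
Lemma Sz_swap n p (i : szS n) (y : X n) : (p.+1 < n)%N ->
  Sz t (swapS p i) (deg X p.+1 y) = Sz t i (deg X p.+1 y).
Proof.
move=> pn; apply: eq_bigr => k _; apply: (@simp_inj G).
rewrite !simp_Sz_factor szseq_swap //.
apply: tfac_swap; rewrite ?szok_szseq ?size_szseq //=.
by rewrite -ltnS.
Qed.

Lemma Sz_degenerate n p (i : szS n.+1) (y : X n.+1) :
  p = 0%N \/ p = n.+1 -> degenerate (X := G) (Sz t i (deg X p y)).
Proof.
have oki := szok_szseq i; have szi := size_szseq i.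
(* q is the vertex whose deletion is invisible: 0 for the first degeneracy, n for the last. *)
move=> p0n; pose q := if p == 0%N then 0%N else n.
have qn : (q < n.+1)%N by rewrite /q; case: ifP.
have jn : (szpos q (szseq i) <= n)%N by have := szpos_lt oki (p := q); lia.
have [|g gE] := @prod_gdeg G _ n (szpos q (szseq i))
  (fun k => szD (X := G) i (Defs.sub_ordK k) (sigma t (face0_iter (deg X p y) k))) jn.
  move=> k; apply: (@simp_degP G); rewrite simp_Sz_factor.
  have kn : (k <= n.+1)%N by rewrite -ltnS.
  rewrite /q; case: p0n => ->; rewrite ?eqxx /=.
    by have := @tfac_first _ _ t _ k (simp y) oki; rewrite szi; apply.
  have := @tfac_last _ _ t (szseq i) k k (simp y) oki.
  by rewrite szi; apply.
by exists (szpos q (szseq i)), g; split; [|exact: gE].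
Qed.

Lemma simp_Szhat_factor n (i : szS n.+1) (p : nat) (y : X n) (k : 'I_n.+1) :
  @simp G n.+1 (szD (X := G) i (sub_ordSK k)
    (sigma t (face0_iter (deg X p y) k))) =
  tact (Dop (szseq i) k.+1) (tfac t k p (simp y)).
Proof.
rewrite simp_szD; congr tact.
by rewrite /tfac -simp_deg -simp_face0_iter // -ltnS.
Qed.

Lemma Szhat_swap n p (i : szS n.+1) (y : X n) : (p < n)%N ->
  Szhat t (swapS p i) (deg X p y) = Szhat t i (deg X p y).
Proof.
move=> pn; have oki := szok_szseq i; have szi := size_szseq i.
congr pair; last first.
  apply: eq_bigr => k _; apply: (@simp_inj G).
  rewrite !simp_Szhat_factor szseq_swap //.
  by apply: tfac_swap; rewrite ?szi //=; lia.
apply: simp_inj; rewrite !simp_szD szseq_swap // simp_deg -[p in tdeg p]subn0.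
by rewrite -(@Dop_swap_lo _ _ _ n) // szi // addn0.
Qed.

Lemma Szhat_degenerate n (i : szS n.+1) (y : X n) :
  degenerate (Szhat t i (deg X n y)).
Proof.
have oki := szok_szseq i; have szi := size_szseq i.
set j := szpos n (szseq i).
have jn : (j <= n)%N by have := szpos_lt oki (p := n); rewrite szi; lia.
have [|g gE] := @prod_gdeg G _ n j
  (fun k => szD (X := G) i (sub_ordSK k) (sigma t (face0_iter (deg X n y) k))) jn.
  move=> k; apply: (@simp_degP G); rewrite simp_Szhat_factor.
  have := @tfac_last _ _ t (szseq i) k.+1 k (simp y) oki.
  by rewrite szi; apply=> //=; lia.
(* The component in [X] is the case k = 0 of [Dop_last], so it is degenerate along the same index j
   as the group component. *)
have [|x xE] := @simp_degP X n j (szD i (addn0 n.+1) (deg X n y)).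
  rewrite simp_szD simp_deg.
  have := @Dop_last (szseq i) 0 n _ (simp y) oki.
  by rewrite szi; apply=> //; rewrite addn0.
by exists j, (x, g); split=> //; congr pair.
Qed.

End Szczarba.

(** * Words of degeneracies and shuffles *)

Section DegeneracyWords.
Variable X : sset.
Implicit Types (u v : tot X) (l : seq nat).

Definition deg_word l : soper := [seq Deg j | j <- l].

Lemma tag_deg_word l u : tag (tact (deg_word l) u) = (size l + tag u)%N.
Proof. by elim: l => //= j l ->. Qed.

Lemma path_gtn_tail n c l : path gtn n.+1 (c :: l) -> path gtn n l.
Proof.
by case: l => //= d l /and3P[cn dc ->]; rewrite andbT; apply: leq_trans dc cn.
Qed.

(** Letters to the left of j are larger, and s_c s_j = s_j s_{c-1} for j < c brings s_j to the front
    with its index unchanged. *)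
Lemma deg_word_mem l j u : path gtn (size l + tag u) l -> j \in l ->
  exists v, tact (deg_word l) u = tdeg j v.
Proof.
elim: l => // c l IH pl; rewrite inE; case: eqP => [-> _|_ /= jl].
  by exists (tact (deg_word l) u).
have pt : path gtn (size l + tag u) l := path_gtn_tail pl.
have [cN cl] : (c < (size l + tag u).+1)%N /\ path gtn c l by apply/andP.
have jc : (j < c)%N := allP (order_path_min (rev_trans ltn_trans) cl) _ jl.
have [v vE] := IH pt jl; have := tag_deg_word l u; rewrite vE /= => tv.
by exists (tdeg c.-1 v); rewrite [RHS]tss ?prednK //; lia.
Qed.

(** Moving left past s_c, an extra s_j keeps its index if j < c and becomes s_{j+1} otherwise, so it
    never takes an index of the word. For a shuffle, its index thus lies in the complementary
    word. *)
Lemma deg_word_deg l p u : path gtn (size l + (tag u).+1) l ->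
  (p <= tag u)%N ->
  exists (j : nat) v,
    [/\ j \notin l, (j <= tag v)%N & tact (deg_word l) (tdeg p u) = tdeg j v].
Proof.
elim: l => [|c l IH] pl pu; first by exists p, u.
have pt : path gtn (size l + (tag u).+1) l := path_gtn_tail pl.
have [cN cl] : (c < (size l + (tag u).+1).+1)%N /\ path gtn c l by apply/andP.
have lc d : d \in l -> (d < c)%N.
  exact: (allP (order_path_min (rev_trans ltn_trans) cl)).
have [j [v [jl jv vE]]] := IH pt pu.
have := tag_deg_word l (tdeg p u); rewrite vE /= => tv.
rewrite /= {}vE; case: (ltnP j c) => jc.
  exists j, (tdeg c.-1 v); split; first by rewrite inE negb_or jl ltn_eqF.
    by rewrite /=; lia.
  by rewrite [RHS]tss ?prednK //; lia.
exists j.+1, (tdeg c v); split; last by rewrite tss // jc.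
  by rewrite inE negb_or gtn_eqF //=; apply/negP => /lc /=; lia.
by rewrite ltnS.
Qed.

End DegeneracyWords.

Section Shuffles.
Variable N : nat.
Implicit Type B : {set 'I_N}.

Definition desc B : seq nat := rev [seq val j | j <- enum B].

Lemma degsE B : degs B = deg_word (desc B).
Proof. by rewrite /degs /deg_word /desc -map_rev -map_comp. Qed.

Lemma mem_desc B (j : 'I_N) : ((j : nat) \in desc B) = (j \in B).
Proof. by rewrite mem_rev (mem_map val_inj) mem_enum. Qed.

Lemma path_desc B : path gtn N (desc B).
Proof.
rewrite (path_sortedE (rev_trans ltn_trans)); apply/andP; split.
  by apply/allP => j; rewrite mem_rev => /mapP[s _ ->]; apply: ltn_ord.
rewrite rev_sorted; apply: (@subseq_sorted _ ltn ltn_trans _ (iota 0 N)).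
  by rewrite -val_enum_ord; apply: map_subseq; rewrite enumT; apply: filter_subseq.
exact: iota_ltn_sorted.
Qed.

Lemma size_desc B : size (desc B) = #|B|.
Proof. by rewrite size_rev size_map -cardE. Qed.

End Shuffles.

(** * Spans of degenerate generators and induced maps *)

Section Chains.
Variable k : comPzRingType.

Section Span.
Variables (K : choiceType) (D : K -> Prop).

Lemma spanned_gen x : D x -> spanned D (gen x : chain k K).
Proof.
move=> Dx; exists [:: (1, x)]; rewrite big_seq1 scale1r; split=> // a.
by rewrite inE => /eqP ->.
Qed.

Lemma spanned_sum (I : finType) (F : I -> chain k K) :
  (forall i, spanned D (F i)) -> spanned D (\sum_i F i).
Proof.
move=> DF; apply: (big_ind (spanned D)) => //; first exact: spanned0.
by move=> a b; apply: spannedD.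
Qed.

End Span.

Lemma spanned_linext (K L : choiceType) (D : K -> Prop) (E : L -> Prop)
    (f : K -> chain k L) (c : chain k K) :
  (forall x, D x -> spanned E (f x)) -> spanned D c -> spanned E (linext f c).
Proof.
move=> DE [s [Ds ->]]; rewrite linear_sum big_seq.
apply: (big_ind (spanned E)); first exact: spanned0.
  by move=> a b; apply: spannedD.
by move=> a /Ds/DE Ea; rewrite linearZ /= linext_gen; apply: spannedZ.
Qed.

Lemma nchain_map (K L : choiceType) (D : K -> Prop) (E : L -> Prop)
    (f : {linear chain k K -> chain k L}) :
  (forall c, spanned D c -> spanned E (f c)) ->
  exists fbar : {linear nchain k D -> nchain k E},
    forall c, fbar (npi D c) = npi E (f c).
Proof.
move=> DE; pose g (x : nchain k D) : nchain k E := npi E (f (repr x)).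
have gE c : g (npi D c) = npi E (f c).
  by apply/npi_eq; rewrite -linearB; apply/DE/repr_npi.
have gL : linear g.
  move=> a x y; rewrite -[x]npi_repr -[y]npi_repr -linearP !gE.
  by rewrite !linearP.
pose gl := GRing.isLinear.Build k (nchain k D) (nchain k E) *:%R g gL.
pose gbar : {linear nchain k D -> nchain k E} := HB.pack g gl.
by exists gbar.
Qed.

(** The involution matches odd terms with even ones. Showing that the sum equals its opposite would
    not suffice, since 2 may be a zero divisor. *)
Lemma alternating_sum_eq0 (I : finType) (V : lmodType k) (h : I -> I)
    (sz : I -> nat) (f : I -> V) : involutive h ->
  (forall i, odd (sz (h i)) = ~~ odd (sz i)) -> (forall i, f (h i) = f i) ->
  \sum_i (-1) ^+ sz i *: f i = 0.
Proof.
move=> hK hodd hf; rewrite (bigID (fun i => odd (sz i))) /=.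
rewrite (reindex_inj (inv_inj hK)) /= -[RHS](subrr
  (\sum_(i | ~~ odd (sz i)) (-1) ^+ sz i *: f i)) addrC -sumrN.
congr (_ + _); apply: eq_big => i; rewrite hodd // => ev.
by rewrite hf -signr_odd hodd -[in RHS]signr_odd (negbTE ev) expr1 expr0 scaleN1r scale1r.
Qed.

End Chains.

(** * Degenerate terms of the shuffle map *)

Lemma degenerate_pair (A B : sset) n (a : A n) (b : B n) j v w : (j < n)%N ->
  simp a = tdeg j v -> simp b = tdeg j w ->
  degenerate (X := sprod A B) (a, b).
Proof.
case: n a b => // n a b jn av bw.
have [|a' ->] := @simp_degP A n j a; first by exists v => //; apply: esym (congr1 tag av).
have [|b' ->] := @simp_degP B n j b; first by exists w => //; apply: esym (congr1 tag bw).
by exists j, (a', b').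
Qed.

Lemma degs_mem (X : sset) N (B : {set 'I_N}) (j : 'I_N) m (x : X m) :
  (#|B| + m = N)%N -> j \in B -> exists v, tact (degs B) (simp x) = tdeg j v.
Proof.
move=> BN jB; rewrite degsE; apply: deg_word_mem; last by rewrite mem_desc.
by rewrite size_desc [X in path _ X]BN path_desc.
Qed.

Lemma degs_degenerate (X : sset) N (B : {set 'I_N}) m (x : X m) :
  (#|B| + m = N)%N -> degenerate x ->
  exists2 j : 'I_N, j \notin B & exists v, tact (degs B) (simp x) = tdeg j v.
Proof.
case: m x => // m x BN [p [y [pm ->]]]; rewrite degsE simp_deg.
have [||j [v [jB jv vE]]] := @deg_word_deg X (desc B) p (simp y); rewrite //=.
  by rewrite size_desc [X in path _ X]BN path_desc.
have jN : (j < N)%N.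
  have := congr1 tag vE; rewrite tag_deg_word size_desc /= BN => ->.
  by rewrite ltnS.
by exists (Ordinal jN); [rewrite -mem_desc|exists v].
Qed.

(** A degenerate argument yields a degeneracy outside its own word, hence one whose index occurs in
    the word applied to the other argument; both components are then degenerate along it. *)
Lemma EZ_term_degenerate (A B : sset) p q (z : A p * B q) (u : shuffle p q) :
  tdegenerate z ->
  degenerate (X := sprod A B)
    (scast (sdim_nu u) (sact (degs (~: val u)) z.1),
     scast (sdim_mu u) (sact (degs (val u)) z.2)).
Proof.
have nuN : (#|~: val u| + p = p + q)%N by rewrite -sdim_degs sdim_nu.
have muN : (#|val u| + q = p + q)%N by rewrite -sdim_degs sdim_mu.
case=> [/(degs_degenerate nuN)|/(degs_degenerate muN)] [j ju [v vE]].
  have [|w wE] := @degs_mem B _ (val u) j q z.2 muN.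
    by rewrite inE negbK in ju.
  by apply: (@degenerate_pair _ _ _ _ _ j v w); rewrite ?simp_scast -?tact_simp.
have [|w wE] := @degs_mem A _ (~: val u) j p z.1 nuN; first by rewrite inE.
by apply: (@degenerate_pair _ _ _ _ _ j w v); rewrite ?simp_scast -?tact_simp.
Qed.

Lemma id_act_degenerate X G (t : twisting X G) (F : gspace G) n
    (z : sprod (twprod t (gspace_self G)) F n) :
  degenerate z -> degenerate (id_act z).
Proof.
case: n z => // n _ [j [[[x g] y] [jn ->]]].
by exists j, (x, act F g y); split; rewrite //= /id_act /= act_deg.
Qed.

Lemma spanned_pushforward_EZ k X G (t : twisting X G) (F : gspace G) n m
    (z : twprod t (gspace_self G) n * F m) : tdegenerate z ->
  spanned (@degenerate (twprod t F) (n + m)%N)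
    (pushforward (@id_act X G t F (n + m)%N) (EZ (gen z)) : chain k _).
Proof.
move=> zD; rewrite /pushforward /EZ linext_gen linear_sum.
apply: spanned_sum => u; rewrite linearZ /= linext_gen.
by apply/spannedZ/spanned_gen/id_act_degenerate/EZ_term_degenerate.
Qed.

(** * Degenerate generators under t and psi *)

Lemma spanned_t_simplex k X G (t : twisting X G) n (x : X n) :
  degenerate x -> spanned (@degenerate G n.-1) (t_simplex k t x).
Proof.
case: n x => // -[|n] _ [p [y [pn ->]]] /=.
  (* In degree 1 the only degeneracy is s_0, and sigma(s_0 y) = 1 gives 1 - 1 = 0. *)
  case: p pn => // _; rewrite /sigma tau_deg0 invg1 subrr; exact: spanned0.
case: (posnP p) => p0.
  by apply: spanned_sum => i; apply/spannedZ/spanned_gen/Sz_degenerate; left.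
case: (ltngtP p n.+1) pn => // pn _; last first.
  by apply: spanned_sum => i; apply/spannedZ/spanned_gen/Sz_degenerate; right.
case: p p0 pn => // p _ pn; rewrite (@alternating_sum_eq0 _ _ _ (@swapS _ p)).
- exact: spanned0.
- exact: swapSK.
- by move=> i; apply: odd_swapS.
- by move=> i; rewrite Sz_swap.
Qed.

Lemma spanned_psi_simplex k X G (t : twisting X G) (F : gspace G) n m
    (z : X n * F m) : tdegenerate z ->
  spanned (@degenerate (twprod t F) (n + m)%N) (psi_simplex k t z).
Proof.
case: z => x y [/= xD|yD]; last first.
  by apply: spanned_sum => i; apply/spannedZ/spanned_pushforward_EZ; right.
case: n x xD => // n _ [p [x [pn ->]]]; rewrite /psi_simplex.
case: (ltngtP p n) pn => // pn _; last first.
  rewrite pn; apply: spanned_sum => i.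
  by apply/spannedZ/spanned_pushforward_EZ; left; apply: Szhat_degenerate.
rewrite (@alternating_sum_eq0 _ _ _ (@swapS _ p)).
- exact: spanned0.
- exact: swapSK.
- by move=> i; apply: odd_swapS.
- by move=> i; congr (pushforward _ (EZ (gen (_, _)))); apply: Szhat_swap.
Qed.

Theorem corollaryB3 (k : comPzRingType) (X : sset) (G : sgroup)
    (t : twisting X G) (F : gspace G) :
  [/\ (forall (n : nat) (c : chains k X n),
         spanned (@degenerate X n) c ->
         spanned (@degenerate G n.-1) (szt t c)),
      (forall (n m : nat) (c : tchains k X F n m),
         spanned (@tdegenerate X F n m) c ->
         spanned (@degenerate (twprod t F) (n + m)%N) (psi t c)),
      (forall n : nat,
         exists tbar : {linear nchains k X n -> nchains k G n.-1},
           forall c : chains k X n,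
             tbar (npi (@degenerate X n) c) =
             npi (@degenerate G n.-1) (szt t c)) &
      (forall n m : nat,
         exists psibar : {linear ntchains k X F n m ->
                                 nchains k (twprod t F) (n + m)%N},
           forall c : tchains k X F n m,
             psibar (npi (@tdegenerate X F n m) c) =
             npi (@degenerate (twprod t F) (n + m)%N) (psi t c))].
Proof.
have tP n (c : chains k X n) : spanned (@degenerate X n) c ->
    spanned (@degenerate G n.-1) (szt t c).
  by apply: spanned_linext => x; apply: spanned_t_simplex.
have psiP n m (c : tchains k X F n m) : spanned (@tdegenerate X F n m) c ->
    spanned (@degenerate (twprod t F) (n + m)%N) (psi t c).
  by apply: spanned_linext => z; apply: spanned_psi_simplex.
split=> // [n|n m].
  exact: (nchain_map (f := linext (@t_simplex k X G t n)) (@tP n)).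
exact: (nchain_map (f := linext (@psi_simplex k X G t F n m)) (@psiP n m)).
Qed.
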